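(* Let $M=\boldsymbol{X}(U)$ be a spacelike surface in $\mathbb{R}^4_1$. Then $M$ is a marginally trapped surface if and only if $\widetilde{H}^+_\ell\equiv0$ or $\widetilde{H}^-_\ell\equiv0$. Moreover, $M$ is a strongly marginally trapped surface if and only if $\widetilde{H}^+_\ell\equiv\widetilde{H}^-_\ell\equiv0$.
   Context: $\mathbb{R}^4_1$ is $\mathbb{R}^4$ with the pseudo scalar product $\langle \boldsymbol{x},\boldsymbol{y}\rangle_1=-x_0y_0+x_1y_1+x_2y_2+x_3y_3$. A nonzero vector $\boldsymbol{x}$ is spacelike, timelike or lightlike if $\langle \boldsymbol{x},\boldsymbol{x}\rangle_1$ is $>0$, $<0$ or $=0$ respectively. Let $\boldsymbol{e}_0=(1,0,0,0)$ and $\|\boldsymbol{x}\|_1=\sqrt{|\langle\boldsymbol{x},\boldsymbol{x}\rangle_1|}$. The wedge product $\boldsymbol{x}_1\wedge\boldsymbol{x}_2\wedge\boldsymbol{x}_3$ is the vector determined by $\langle\boldsymbol{x},\boldsymbol{x}_1\wedge\boldsymbol{x}_2\wedge\boldsymbol{x}_3\rangle_1=\det(\boldsymbol{x},\boldsymbol{x}_1,\boldsymbol{x}_2,\boldsymbol{x}_3)$ for all $\boldsymbol{x}$. A spacelike surface is $M=\boldsymbol{X}(U)$, where $U\subset\mathbb{R}^2$ is open and $\boldsymbol{X}:U\to\mathbb{R}^4_1$ is a smooth embedding all of whose tangent planes $T_pM$ consist (apart from $0$) of spacelike vectors; $M$ is identified with $U$ via $\boldsymbol{X}$. A future directed normal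 frame is a pair $(\boldsymbol{n}^T,\boldsymbol{n}^S)$ of smooth normal fields along $M$ where $\boldsymbol{n}^T$ is unit timelike, future directed ($\langle\boldsymbol{n}^T,\boldsymbol{e}_0\rangle_1<0$), and $\boldsymbol{n}^S=\dfrac{\boldsymbol{n}^T\wedge\boldsymbol{X}_{u_1}\wedge\boldsymbol{X}_{u_2}}{\|\boldsymbol{n}^T\wedge\boldsymbol{X}_{u_1}\wedge\boldsymbol{X}_{u_2}\|_1}$ (unit spacelike, orthogonal to $\boldsymbol{n}^T$). Let $\pi^t:T_p\mathbb{R}^4_1=T_pM\oplus N_p(M)\to T_pM$ be the orthogonal projection, $S_p(\boldsymbol{n}^T)=-\pi^t\circ d_p\boldsymbol{n}^T$, $S_p(\boldsymbol{n}^S)=-\pi^t\circ d_p\boldsymbol{n}^S$. The mean curvature vector is $\mathfrak{H}(p)=\frac12\mathrm{Trace}\,S_p(\boldsymbol{n}^T)\,\boldsymbol{n}^T+\frac12\mathrm{Trace}\,S_p(\boldsymbol{n}^S)\,\boldsymbol{n}^S$. $M$ is marginally trapped if $\mathfrak{H}(p)$ is isotropic (zero or lightlike) at every $p\in M$, and strongly marginally trapped if $\mathfrak{H}(p)=\boldsymbol{0}$ at every $p\in M$. For a lightlike vector $\boldsymbol{x}=(x_0,x_1,x_2,x_3)$ put $\widetilde{\boldsymbol{x}}=(1,x_1/x_0,x_2/x_0,x_3/x_0)$, a point of $S^2_+=\{\boldsymbol{x}:\langle\boldsymbol{x},\boldsymbol{x}\rangle_1=0,\ x_0=1\}$. The lightcone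 Gauss maps $\widetilde{\mathbb{L}}^\pm:U\to S^2_+$, $\widetilde{\mathbb{L}}^\pm(u)=\widetilde{(\boldsymbol{n}^T\pm\boldsymbol{n}^S)}(u)$, do not depend on the choice of $\boldsymbol{n}^T$. The normalized lightcone shape operators are $\widetilde{S}^\pm_p=-\pi^t\circ d\widetilde{\mathbb{L}}^\pm_p$, and the normalized lightcone mean curvatures are $\widetilde{H}^\pm_\ell(p)=\frac12\mathrm{Trace}\,\widetilde{S}^\pm_p$.
   Formalization: The first equivalence is proved with ''H̃⁺=0 or H̃⁻=0'' taken at each point p, not as ''H̃⁺≡0 or H̃⁻≡0''; the literal ''only if'' fails for X=(f+g,f−g,u,v) with f, g smooth, non-harmonic and supported in disjoint discs. *)

(* Defs.v *)
From HB Require Import structures.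
From mathcomp Require Import all_boot all_order all_algebra.
From mathcomp Require Import all_classical all_reals all_analysis.

Set Implicit Arguments.
Unset Strict Implicit.
Unset Printing Implicit Defensive.

Import Order.TTheory GRing.Theory Num.Theory.
Import numFieldNormedType.Exports.

Local Open Scope classical_set_scope.
Local Open Scope ring_scope.

Section Minkowski.
Context {R : realType}.
Implicit Types x y : 'rV[R]_4.

Definition eta : 'M[R]_4 := diag_mx (\row_(j < 4) (if j == 0 then -1 else 1)).

Definition mink x y : R := (x *m eta *m y^T) 0 0.

Lemma minkE x y :
  mink x y = - (x 0 0 * y 0 0) + x 0 1 * y 0 1 + x 0 2 * y 0 2 + x 0 3 * y 0 3.
Proof.
rewrite /mink mxE !big_ord_recl big_ord0 !mul_mx_diag !mxE /= addr0.
rewrite !mulr1 mulrN1 mulNr !addrA.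
by congr (_ + _ * _ + _ * _ + _ * _); congr (_ _ _); apply: val_inj.
Qed.

Definition spacelike x : Prop := x != 0 /\ 0 < mink x x.
Definition timelike x : Prop := x != 0 /\ mink x x < 0.
Definition lightlike x : Prop := x != 0 /\ mink x x = 0.
Definition isotropic x : Prop := x = 0 \/ lightlike x.

Definition e0 : 'rV[R]_4 := delta_mx 0 0.

Definition norm1 x : R := Num.sqrt `|mink x x|.

Definition det4 (x x1 x2 x3 : 'rV[R]_4) : R :=
  \det (\matrix_(i < 4) [:: x; x1; x2; x3]`_i).

(* The factor [eta] raises the index of the covector [det4 _ x1 x2 x3];
   [wedgeP] and [wedge_uniq] give the characterization by duality. *)
Definition wedge (x1 x2 x3 : 'rV[R]_4) : 'rV[R]_4 :=
  (\row_j det4 (delta_mx 0 j) x1 x2 x3) *m eta.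

Lemma eta_sqr : eta *m eta = 1%:M.
Proof.
rewrite /eta mulmx_diag -diag_const_mx; congr diag_mx; apply/rowP => j.
by rewrite !mxE; case: eqP => _; rewrite ?mulrNN mulr1.
Qed.

Lemma wedgeP x x1 x2 x3 : mink x (wedge x1 x2 x3) = det4 x x1 x2 x3.
Proof.
rewrite /mink /wedge trmx_mul tr_diag_mx mulmxA -(mulmxA x) eta_sqr mulmx1.
rewrite mxE /det4 (expand_det_row _ 0); apply: eq_bigr => j _.
rewrite !mxE /=; congr (_ * _).
rewrite (expand_det_row _ 0) (bigD1 j) //= big1 ?addr0 => [|k kj].
  rewrite !mxE /= !eqxx mul1r /cofactor; congr (_ * \det _).
  by apply/matrixP => a b; rewrite !mxE.
by rewrite !mxE /= (negbTE kj) mul0r.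
Qed.

Lemma wedge_uniq w x1 x2 x3 :
  (forall x, mink x w = det4 x x1 x2 x3) -> w = wedge x1 x2 x3.
Proof.
move=> H.
have {H} : forall x, mink x w = mink x (wedge x1 x2 x3).
  by move=> x; rewrite wedgeP.
move=> H; apply/rowP => j; have := H (delta_mx 0 j *m eta).
by rewrite /mink -(mulmxA _ eta eta) eta_sqr mulmx1 -!rowE !mxE.
Qed.

End Minkowski.

Section SpacelikeSurface.
Context {R : realType}.
Implicit Types (U : set 'rV[R]_2) (X n nT nS : 'rV[R]_2 -> 'rV[R]_4).
Implicit Types (p : 'rV[R]_2).

Definition partial m (i : 'I_2) (f : 'rV[R]_2 -> 'rV[R]_m) p : 'rV[R]_m :=
  'D_(delta_mx 0 i) f p.

Fixpoint Ck m (k : nat) U (f : 'rV[R]_2 -> 'rV[R]_m) : Prop :=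
  match k with
  | 0 => forall p, U p -> {for p, continuous f}
  | k'.+1 => (forall p, U p -> differentiable f p) /\
             (forall i, Ck k' U (partial i f))
  end.

Definition smooth m U (f : 'rV[R]_2 -> 'rV[R]_m) : Prop :=
  forall k, Ck k U f.

Definition smooth_embedding U X : Prop :=
  [/\ smooth U X,
      forall p, U p -> injective ('d X p)
    & exists2 g : 'rV[R]_4 -> 'rV[R]_2,
        {within X @` U, continuous g} & forall p, U p -> g (X p) = p].

(* Subspaces of R^4_1 are row spaces of square matrices. The rows of
   ['J X p] are the vectors X_{u_1}(p), X_{u_2}(p). *)
Definition tangent_plane X p : 'M[R]_4 := <<'J X p>>%MS.

Definition normal_plane X p : 'M[R]_4 := kermx (eta *m ('J X p)^T).

Lemma normal_planeP X p (v : 'rV[R]_4) :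
  (v <= normal_plane X p)%MS <->
  (forall w : 'rV[R]_4, (w <= tangent_plane X p)%MS -> mink v w = 0).
Proof.
split=> [/sub_kermxP vN w|vN].
  rewrite genmxE => /submxP[a ->].
  by rewrite /mink trmx_mul mulmxA -(mulmxA v) vN mul0mx mxE.
apply/sub_kermxP/rowP => j; rewrite mulmxA.
have := vN (row j ('J X p)); rewrite genmxE row_sub => /(_ isT).
move=> H; rewrite [RHS]mxE -H /mink mxE [RHS]mxE.
by apply: eq_bigr => k _; congr (_ * _); rewrite !mxE.
Qed.

Definition spacelike_surface U X : Prop :=
  [/\ open U, smooth_embedding U X
    & forall p, U p -> forall v : 'rV[R]_4,
        (v <= tangent_plane X p)%MS -> v != 0 -> spacelike v].

Definition normal_field U X n : Prop :=
  forall p, U p -> (n p <= normal_plane X p)%MS.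

Definition future_normal_frame U X nT nS : Prop :=
  [/\ smooth U nT /\ normal_field U X nT,
      smooth U nS /\ normal_field U X nS,
      forall p, U p -> timelike (nT p) /\ norm1 (nT p) = 1,
      forall p, U p -> mink (nT p) e0 < 0
    & forall p, U p ->
        let w := wedge (nT p) (partial 0 X p) (partial 1 X p) in
        nS p = (norm1 w)^-1 *: w].

Definition tangent_proj X p : 'M[R]_4 :=
  proj_mx (tangent_plane X p) (normal_plane X p).

(* [pinvmx ('J X p)] sends a tangent vector a_1 X_{u_1} + a_2 X_{u_2} to its
   coordinates (a_1, a_2), so on the tangent plane this is d_pn, with M
   identified with U via X: it sends X_{u_i} to n_{u_i}. *)
Definition field_diff X n p : 'M[R]_4 := pinvmx ('J X p) *m 'J n p.

Definition shape_op X n p : 'M[R]_4 :=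
  - (field_diff X n p *m tangent_proj X p).

(* The trace of the restriction of [shape_op] to the tangent plane, [conjmx]
   being the matrix of that restriction in the basis X_{u_1}, X_{u_2}. *)
Definition trace_shape X n p : R := \tr (conjmx ('J X p) (shape_op X n p)).

Definition mean_curvature_vector X nT nS p : 'rV[R]_4 :=
  (2^-1 * trace_shape X nT p) *: nT p + (2^-1 * trace_shape X nS p) *: nS p.

Definition marginally_trapped U X nT nS : Prop :=
  forall p, U p -> isotropic (mean_curvature_vector X nT nS p).

Definition strongly_marginally_trapped U X nT nS : Prop :=
  forall p, U p -> mean_curvature_vector X nT nS p = 0.

Definition lightcone_normalize (x : 'rV[R]_4) : 'rV[R]_4 :=
  \row_j (if j == 0 then 1 else x 0 j / x 0 0).

Definition gauss_plus nT nS p := lightcone_normalize (nT p + nS p).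
Definition gauss_minus nT nS p := lightcone_normalize (nT p - nS p).

Definition lightcone_mean_curvature_plus X nT nS p : R :=
  2^-1 * trace_shape X (gauss_plus nT nS) p.
Definition lightcone_mean_curvature_minus X nT nS p : R :=
  2^-1 * trace_shape X (gauss_minus nT nS) p.

End SpacelikeSurface.

(* Main.v *)
From HB Require Import structures.
Require Import Defs.
From mathcomp Require Import all_boot all_order all_algebra.
From mathcomp Require Import all_classical all_reals all_analysis.
From mathcomp Require Import ring lra.

Set Implicit Arguments.
Unset Strict Implicit.
Unset Printing Implicit Defensive.

Import Order.TTheory GRing.Theory Num.Theory.
Import numFieldNormedType.Exports.

Local Open Scope ring_scope.

(** The equivalences hold at each point separately, because they only compare
    four traces. Let [a] and [b] be the traces of the shape operators of [nT]
    and [nS]. Since [nT], [nS] is an orthonormal basis of a Lorentzian plane,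
    the mean curvature vector [H = (a nT + b nS) / 2] has
    [mink H H = (b - a) (b + a) / 4], and it vanishes only if [a = b = 0].

    On the other side, [nT + nS] and [nT - nS] are nonzero null vectors, so
    their time coordinate [l] is nonzero, and the lightcone Gauss maps are these
    fields divided by [l]. The differential of [v / l] is [dv / l] plus a
    multiple of [v]; as [v] is normal, the tangential projection kills the
    second term, so that the normalized shape operators have traces
    [(a + b) / l] and [(a - b) / l'] with [l] and [l'] the two time coordinates
    ([trace_shape_lightcone_normalize], [trace_gauss_plus_eq0]). Hence
    [mink H H = 0] says that one of these traces vanishes, and [H = 0] that both
    do.

    What takes work is the claim that [nS] has square norm [1]: it is a
    normalized wedge product, and one must see that this wedge product is
    spacelike and not zero. Its square norm is minus the Gram determinant of its
    three factors ([mink_wedge_gram]), which here is the Gram determinant of the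
    tangent frame, positive by the Cauchy-Schwarz inequality on a spacelike
    plane. *)

(** * Bilinear algebra of Minkowski space *)

Lemma minkC (R : realType) (x y : 'rV[R]_4) : mink x y = mink y x.
Proof. by rewrite !minkE; ring. Qed.

Lemma minkDl (R : realType) (x y z : 'rV[R]_4) :
  mink (x + y) z = mink x z + mink y z.
Proof. by rewrite !minkE !mxE; ring. Qed.

Lemma minkZl (R : realType) (a : R) (x y : 'rV[R]_4) :
  mink (a *: x) y = a * mink x y.
Proof. by rewrite !minkE !mxE; ring. Qed.

Lemma minkDr (R : realType) (x y z : 'rV[R]_4) :
  mink z (x + y) = mink z x + mink z y.
Proof. by rewrite !(minkC z) minkDl. Qed.

Lemma minkZr (R : realType) (a : R) (x y : 'rV[R]_4) :
  mink x (a *: y) = a * mink x y.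
Proof. by rewrite !(minkC x) minkZl. Qed.

Lemma minkNr (R : realType) (x y : 'rV[R]_4) : mink x (- y) = - mink x y.
Proof. by rewrite -scaleN1r minkZr mulN1r. Qed.

Lemma mink0r (R : realType) (x : 'rV[R]_4) : mink x 0 = 0.
Proof. by rewrite -(scale0r 0) minkZr mul0r. Qed.

Lemma isotropicP (R : realType) (x : 'rV[R]_4) : isotropic x <-> mink x x = 0.
Proof.
split=> [[->|[_ //]]|xx]; first exact: mink0r.
by case: (eqVneq x 0) => [|x0]; [left | right].
Qed.

(** A null vector with zero time coordinate has zero Euclidean norm. *)
Lemma null_time_neq0 (R : realType) (x : 'rV[R]_4) :
  mink x x = 0 -> x != 0 -> x 0 0 != 0.
Proof.
move=> xx xN0; apply: contraNN xN0 => /eqP x00.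
move: xx; rewrite minkE x00 mulr0 oppr0 add0r -!expr2 => /eqP.
rewrite !paddr_eq0 ?addr_ge0 ?sqr_ge0// !sqrf_eq0.
move=> /andP[/andP[/eqP x1 /eqP x2] /eqP x3].
apply/eqP/rowP => j; rewrite mxE.
case: j => -[|[|[|[|//]]]] lt_j;
  [rewrite -[RHS]x00|rewrite -[RHS]x1|rewrite -[RHS]x2|rewrite -[RHS]x3];
  congr (x 0 _); exact: val_inj.
Qed.

Lemma mink_lincomb (R : realType) (x y : 'rV[R]_4) (a b : R) :
  mink x x = -1 -> mink y y = 1 -> mink x y = 0 ->
  mink (a *: x + b *: y) (a *: x + b *: y) = (b - a) * (b + a).
Proof.
move=> xx yy xy; rewrite !minkDl !minkDr !minkZl !minkZr (minkC y x) xx yy xy.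
ring.
Qed.

Lemma orthonormal_lincomb_eq0 (R : realType) (x y : 'rV[R]_4) (a b : R) :
  mink x x = -1 -> mink y y = 1 -> mink x y = 0 ->
  a *: x + b *: y = 0 -> a = 0 /\ b = 0.
Proof.
move=> xx yy xy e.
have := congr1 (mink x) e; have := congr1 (mink y) e.
rewrite !minkDr !minkZr !mink0r (minkC y x) xx yy xy.
by move=> h1 h2; split; lra.
Qed.

Lemma isotropic_half_lincomb (R : realType) (x y : 'rV[R]_4) (a b : R) :
  mink x x = -1 -> mink y y = 1 -> mink x y = 0 ->
  isotropic ((2^-1 * a) *: x + (2^-1 * b) *: y) <-> a + b = 0 \/ a - b = 0.
Proof.
move=> xx yy xy; apply: iff_trans (isotropicP _) _; rewrite mink_lincomb//.
split=> [/eqP|[h|h]].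
- by rewrite mulf_eq0 => /orP[] /eqP h; [right | left]; lra.
- have -> : b = - a by lra.
  ring.
- have -> : b = a by lra.
  ring.
Qed.

Lemma half_lincomb_eq0 (R : realType) (x y : 'rV[R]_4) (a b : R) :
  mink x x = -1 -> mink y y = 1 -> mink x y = 0 ->
  (2^-1 * a) *: x + (2^-1 * b) *: y = 0 <-> a + b = 0 /\ a - b = 0.
Proof.
move=> xx yy xy; split=> [/(orthonormal_lincomb_eq0 xx yy xy)[h1 h2]|[h1 h2]].
  by split; lra.
have -> : a = 0 by lra.
have -> : b = 0 by lra.
by rewrite mulr0 !scale0r addr0.
Qed.

(** [x + y] is a nonzero null vector. *)
Lemma orthonormal_sum_time_neq0 (R : realType) (x y : 'rV[R]_4) :
  mink x x = -1 -> mink y y = 1 -> mink x y = 0 -> (x + y) 0 0 != 0.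
Proof.
move=> xx yy xy; have e : x + y = 1 *: x + 1 *: y by rewrite !scale1r.
apply: null_time_neq0; first by rewrite e mink_lincomb// subrr mul0r.
apply/eqP; rewrite e => /(orthonormal_lincomb_eq0 xx yy xy)[/eqP].
by rewrite oner_eq0.
Qed.

Lemma mink_norm1_normalize (R : realType) (x : 'rV[R]_4) :
  0 < mink x x -> mink ((norm1 x)^-1 *: x) ((norm1 x)^-1 *: x) = 1.
Proof.
move=> x0; rewrite minkZl minkZr mulrA -expr2 exprVn sqr_sqrtr ?normr_ge0//.
by rewrite gtr0_norm// mulVf// gt_eqF.
Qed.

(** * The square norm of a wedge product *)

Lemma det2E (R : comRingType) (A : 'M[R]_2) :
  \det A = A 0 0 * A 1 1 - A 0 1 * A 1 0.
Proof.
(* Indexing the entries by naturals makes equal ordinals convertible. *)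
pose a i j := A (inord i) (inord j).
have e (i j : 'I_2) : A i j = a i j by rewrite /a !inord_val.
rewrite (expand_det_row _ 0) !big_ord_recl big_ord0 /cofactor !det_mx11 !mxE.
rewrite !e /=; ring.
Qed.

Lemma det3E (R : comRingType) (A : 'M[R]_3) :
  \det A = A 0 0 * (A 1 1 * A 2 2 - A 1 2 * A 2 1)
         - A 0 1 * (A 1 0 * A 2 2 - A 1 2 * A 2 0)
         + A 0 2 * (A 1 0 * A 2 1 - A 1 1 * A 2 0).
Proof.
pose a i j := A (inord i) (inord j).
have e (i j : 'I_3) : A i j = a i j by rewrite /a !inord_val.
rewrite (expand_det_row _ 0) !big_ord_recl big_ord0 /cofactor !det2E !mxE.
rewrite !e /=; ring.
Qed.

(** The minor of the rows [x], [y], [z] in the columns [i], [j], [k]. *)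
Definition minor3 (R : realType) (x y z : 'rV[R]_4) (i j k : 'I_4) : R :=
  x 0 i * (y 0 j * z 0 k - y 0 k * z 0 j)
  - x 0 j * (y 0 i * z 0 k - y 0 k * z 0 i)
  + x 0 k * (y 0 i * z 0 j - y 0 j * z 0 i).

Lemma det4E (R : realType) (x y z w : 'rV[R]_4) :
  det4 x y z w = x 0 0 * minor3 y z w 1 2 3 - x 0 1 * minor3 y z w 0 2 3
               + x 0 2 * minor3 y z w 0 1 3 - x 0 3 * minor3 y z w 0 1 2.
Proof.
pose c (v : 'rV[R]_4) j := v 0 (inord j).
have e (v : 'rV[R]_4) j : v 0 j = c v j by rewrite /c inord_val.
rewrite /det4 (expand_det_row _ 0) !big_ord_recl big_ord0 /cofactor !det3E.
rewrite !mxE /minor3 !e /=; ring.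
Qed.

Lemma mink_wedgeE (R : realType) (x y z : 'rV[R]_4) :
  mink (wedge x y z) (wedge x y z) =
    - minor3 x y z 1 2 3 ^+ 2 + minor3 x y z 0 2 3 ^+ 2
    + minor3 x y z 0 1 3 ^+ 2 + minor3 x y z 0 1 2 ^+ 2.
Proof.
rewrite minkE /wedge /eta !mul_mx_diag !mxE !det4E !mxE /=.
by ring.
Qed.

(** The Lorentzian Cauchy-Binet identity; the sign is the determinant of the
    metric. *)
Lemma mink_wedge_gram (R : realType) (x y z : 'rV[R]_4) :
  mink (wedge x y z) (wedge x y z) =
  - (mink x x * (mink y y * mink z z - mink y z ^+ 2)
     - mink x y * (mink x y * mink z z - mink y z * mink x z)
     + mink x z * (mink x y * mink y z - mink y y * mink x z)).
Proof. by rewrite mink_wedgeE /minor3 !minkE; ring. Qed.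

Lemma mink_wedge_normal (R : realType) (x y z : 'rV[R]_4) :
  mink x x = -1 -> mink x y = 0 -> mink x z = 0 ->
  mink (wedge x y z) (wedge x y z) = mink y y * mink z z - mink y z ^+ 2.
Proof. by move=> xx xy xz; rewrite mink_wedge_gram xx xy xz; ring. Qed.

Lemma mink_wedgel (R : realType) (x y z : 'rV[R]_4) : mink x (wedge x y z) = 0.
Proof. by rewrite wedgeP det4E /minor3; ring. Qed.

(** * Differentials of rescaled vector fields *)

Lemma scale_is_bilinear (R : numFieldType) (W : normedModType R) :
  bilinear_for
    (GRing.Scale.Law.clone _ _ *:%R _) (GRing.Scale.Law.clone _ _ *:%R _)
    (@GRing.scale R W).
Proof.
split=> [w|k] a x y /=; first by rewrite scalerDl scalerA.
by rewrite scalerDr !scalerA mulrC.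
Qed.

HB.instance Definition _ (R : numFieldType) (W : normedModType R) :=
  bilinear_isBilinear.Build R R W W _ _ (@GRing.scale R W)
    (scale_is_bilinear W).

Lemma is_diff_scale (R : numFieldType) (V W : normedModType R)
    (k dk : V -> R) (f df : V -> W) (x : V) :
  is_diff x k dk -> is_diff x f df ->
  is_diff x (fun y => k y *: f y) (fun h => k x *: df h + dk h *: f x).
Proof.
move=> dkx dfx.
have sc : continuous (fun q : R * W => q.1 *: q.2) by exact: scale_continuous.
have dsc : is_diff (k x, f x) (fun q : R * W => q.1 *: q.2)
             (fun q => k x *: q.2 + q.1 *: f x).
  by apply: DiffDef; [apply: differentiable_bilin | rewrite diff_bilin].
exact: (is_diff_comp (is_diff_pair dkx dfx) dsc).
Qed.

(** The map [y |-> e + (f y - l y e) / l y] is [f / l] wherever [l] does not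
    vanish, so the formula is the quotient rule. This way of writing the quotient
    agrees with [lightcone_normalize] at the zeros of [l] too
    ([lightcone_normalizeE]), and so allows rewriting under the differential. *)
Lemma is_diff_central_proj (R : numFieldType) (V W : normedModType R) (e : W)
    (l dl : V -> R) (f df : V -> W) (x : V) :
  is_diff x l dl -> is_diff x f df -> l x != 0 ->
  is_diff x (fun y => e + (l y)^-1 *: (f y - l y *: e))
    (fun h => (l x)^-1 *: df h - ((l x) ^- 2 * dl h) *: f x).
Proof.
move=> dlx dfx lx0.
have dlV : is_diff x (fun y => (l y)^-1) (fun h => - (l x) ^- 2 * dl h).
  by apply: DiffDef; [exact: differentiableV | rewrite diffV// diff_val].
have dle := is_diff_scale dlx (is_diff_cst e x).
have H := is_diffD (is_diff_cst e x) (is_diff_scale dlV (is_diffB dfx dle)).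
apply: (is_diff_eq (f' := _) H).
apply/funext => h; rewrite !fctE /= add0r scaler0 add0r mulNr scaleNr.
have lK : l x ^- 2 * dl h * l x = (l x)^-1 * dl h by field.
by rewrite !scalerBr !scalerA lK opprB addrA subrK.
Qed.

Lemma jacobianE (R : realType) m n (f df : 'rV[R]_m -> 'rV[R]_n) p :
  is_diff p f df -> 'J f p = lin1_mx df.
Proof. by move=> fdf; rewrite /jacobian diff_val. Qed.

Lemma jacobianD (R : realType) m n (f g : 'rV[R]_m -> 'rV[R]_n) p :
  differentiable f p -> differentiable g p ->
  'J (f + g) p = 'J f p + 'J g p.
Proof.
move=> df dg.
apply: etrans (jacobianE (is_diffD (differentiableP df) (differentiableP dg))) _.
rewrite /jacobian; move: ('d f p) ('d g p) => dfp dgp.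
by apply/matrixP => i j; rewrite !mxE.
Qed.

Lemma jacobianN (R : realType) m n (f : 'rV[R]_m -> 'rV[R]_n) p :
  differentiable f p -> 'J (- f) p = - 'J f p.
Proof.
move=> df; apply: etrans (jacobianE (is_diffN (differentiableP df))) _.
rewrite /jacobian; move: ('d f p) => dfp.
by apply/matrixP => i j; rewrite !mxE.
Qed.

Lemma row_free_jacobian (R : realType) m n (f : 'rV[R]_m -> 'rV[R]_n) p :
  injective ('d f p) -> row_free ('J f p).
Proof.
move=> inj; suff /eqP : kermx ('J f p) = 0 by rewrite kermx_eq0.
apply/row_matrixP => i; rewrite row0; apply: inj; rewrite linear0.
have /(congr1 (row i)) := mulmx_ker ('J f p).
by rewrite row_mul row0 => <-; rewrite mul_rV_lin1.
Qed.

Lemma partialE (R : realType) m (f : 'rV[R]_2 -> 'rV[R]_m) i p :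
  differentiable f p -> partial i f p = row i ('J f p).
Proof. by move=> df; rewrite /partial deriveEjacobian// rowE. Qed.

Lemma lightcone_normalizeE (R : realType) (x : 'rV[R]_4) :
  lightcone_normalize x = e0 + (x 0 0)^-1 *: (x - x 0 0 *: e0).
Proof.
apply/rowP => j; rewrite !mxE eqxx /=.
case: eqP => [->|_]; first by rewrite mulr1 subrr mulr0 addr0.
by rewrite mulr0 subr0 add0r mulrC.
Qed.

(** The rank one term [a *m v p], whose rows are multiples of [v p], comes from
    the derivative of the scaling factor. *)
Lemma jacobian_lightcone_normalize (R : realType)
    (v : 'rV[R]_2 -> 'rV[R]_4) p :
  differentiable v p -> v p 0 0 != 0 ->
  exists a : 'cV[R]_2, 'J (fun q => lightcone_normalize (v q)) p =
    (v p 0 0)^-1 *: 'J v p + a *m v p.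
Proof.
move=> dv v0; set l := fun q => v q 0 0.
have dl : differentiable l p.
  exact: (@differentiable_comp _ _ _ _ v (fun N : 'rV[R]_4 => N 0 0) p dv
           (differentiable_coord (v p) 0 0)).
have E : (fun q => lightcone_normalize (v q)) =
   (fun q => (e0 : 'rV[R]_4) + (l q)^-1 *: (v q - l q *: e0)).
  by apply/funext => q; rewrite lightcone_normalizeE.
have dg := is_diff_central_proj e0 (differentiableP dl) (differentiableP dv) v0.
exists (\col_i (- (l p) ^- 2 * 'd l p (delta_mx 0 i))).
rewrite E (jacobianE dg) /jacobian.
move: ('d v p) ('d l p) => dvp dlp.
by apply/matrixP => i j; rewrite !mxE big_ord1 !mxE !mulNr.
Qed.

(** * Traces of shape operators *)

(** Conjugation by the tangent frame cancels the [pinvmx] of [field_diff]; what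
    is left is linear in the Jacobian of the field. *)
Lemma trace_shapeE (R : realType) (X v : 'rV[R]_2 -> 'rV[R]_4) p :
  row_free ('J X p) ->
  trace_shape X v p = - \tr ('J v p *m tangent_proj X p *m pinvmx ('J X p)).
Proof.
rewrite /trace_shape /shape_op /field_diff /conjmx.
move: (tangent_proj X p) ('J v p) => P Jv; move: ('J X p) => J Jfree.
move: (mulmxVp Jfree); move: (pinvmx J) => Q JQ.
by rewrite mulmxN mulNmx !mulmxA JQ mul1mx raddfN.
Qed.

Lemma trace_shapeD (R : realType) (X v w : 'rV[R]_2 -> 'rV[R]_4) p :
  row_free ('J X p) -> differentiable v p -> differentiable w p ->
  trace_shape X (v + w) p = trace_shape X v p + trace_shape X w p.
Proof.
move=> Xf dv dw; rewrite !trace_shapeE// jacobianD//.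
move: ('J v p) ('J w p) (tangent_proj X p) (pinvmx _) => Jv Jw P Q.
by rewrite !mulmxDl raddfD opprD.
Qed.

Lemma trace_shapeN (R : realType) (X v : 'rV[R]_2 -> 'rV[R]_4) p :
  row_free ('J X p) -> differentiable v p ->
  trace_shape X (- v) p = - trace_shape X v p.
Proof.
move=> Xf dv; rewrite !trace_shapeE// jacobianN//.
move: ('J v p) (tangent_proj X p) (pinvmx _) => Jv P Q.
by rewrite !mulNmx raddfN.
Qed.

(** The derivative of the scaling factor only contributes multiples of the
    normal vector [v p], which the tangential projection kills. *)
Lemma trace_shape_lightcone_normalize (R : realType)
    (X v : 'rV[R]_2 -> 'rV[R]_4) p :
  row_free ('J X p) -> (tangent_plane X p :&: normal_plane X p = 0)%MS ->
  differentiable v p -> (v p <= normal_plane X p)%MS -> v p 0 0 != 0 ->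
  trace_shape X (fun q => lightcone_normalize (v q)) p =
    (v p 0 0)^-1 * trace_shape X v p.
Proof.
move=> Xf TN0 dv vN v0; rewrite !trace_shapeE//.
have [a ->] := jacobian_lightcone_normalize dv v0.
have : v p *m tangent_proj X p = 0 by rewrite proj_mx_0.
move: ('J v p) (tangent_proj X p) (pinvmx _) => Jv P Q vP.
rewrite 2!mulmxDl -(mulmxA a) vP mulmx0 mul0mx addr0.
by rewrite -!scalemxAl mxtraceZ mulrN.
Qed.

(** Both lightcone Gauss maps are covered: [gauss_minus nT nS] is
    [gauss_plus nT (- nS)]. *)
Lemma trace_gauss_plus_eq0 (R : realType)
    (X v w : 'rV[R]_2 -> 'rV[R]_4) p :
  row_free ('J X p) -> (tangent_plane X p :&: normal_plane X p = 0)%MS ->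
  differentiable v p -> differentiable w p ->
  (v p <= normal_plane X p)%MS -> (w p <= normal_plane X p)%MS ->
  mink (v p) (v p) = -1 -> mink (w p) (w p) = 1 -> mink (v p) (w p) = 0 ->
  (trace_shape X (gauss_plus v w) p == 0) =
  (trace_shape X v p + trace_shape X w p == 0).
Proof.
move=> Xf TN0 dv dw vN wN vv ww vw.
have t0 := orthonormal_sum_time_neq0 vv ww vw.
have := trace_shape_lightcone_normalize Xf TN0 (differentiableD dv dw)
  (addmx_sub vN wN) t0.
rewrite (trace_shapeD Xf dv dw) => E.
by apply: etrans (congr1 (eq_op^~ 0) E) _; rewrite mulf_eq0 invr_eq0 (negbTE t0).
Qed.

(** * Spacelike tangent planes *)

(** A vector that is both tangent and normal is orthogonal to itself. *)
Lemma tangent_normal_trivial (R : realType) (X : 'rV[R]_2 -> 'rV[R]_4) p :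
  (forall v : 'rV[R]_4, (v <= tangent_plane X p)%MS -> v != 0 -> spacelike v) ->
  (tangent_plane X p :&: normal_plane X p = 0)%MS.
Proof.
move=> sp; apply/eqP; rewrite -submx0; apply/rV_subP => v.
rewrite sub_capmx => /andP[vT /normal_planeP vN].
case: (eqVneq v 0) => [->|v0]; first exact: sub0mx.
by have [_] := sp v vT v0; rewrite vN// ltxx.
Qed.

(** The first fundamental form is positive definite. *)
Lemma gram_spacelike_gt0 (R : realType) (X : 'rV[R]_2 -> 'rV[R]_4) p :
  (forall v : 'rV[R]_4, (v <= tangent_plane X p)%MS -> v != 0 -> spacelike v) ->
  row_free ('J X p) ->
  0 < mink (row 0 ('J X p)) (row 0 ('J X p))
      * mink (row 1 ('J X p)) (row 1 ('J X p))
      - mink (row 0 ('J X p)) (row 1 ('J X p)) ^+ 2.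
Proof.
move=> sp Xf; set a := row 0 _; set b := row 1 _.
have pos s t : (s != 0) || (t != 0) ->
    0 < mink (s *: a + t *: b) (s *: a + t *: b).
  move=> st.
  have e : s *: a + t *: b =
      (\row_(j < 2) if j == 0 then s else t) *m 'J X p.
    rewrite mulmx_sum_row big_ord_recl big_ord1 !mxE /=.
    by congr (_ + _ *: row _ _); apply: val_inj.
  have [||//] := sp (s *: a + t *: b); first by rewrite genmxE e submxMl.
  rewrite e; apply: contraTneq st => /(congr1 (mulmxr (pinvmx ('J X p)))) /=.
  rewrite mulmxKp// mul0mx => /rowP h.
  have := h 0; have := h 1; rewrite !mxE /= => -> ->.
  by rewrite eqxx.
have b0 : 0 < mink b b.
  by have := pos 0 1; rewrite oner_eq0 orbT scale0r add0r scale1r; apply.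
(* This combination is orthogonal to [b]; its square norm is [mink b b] times
   the determinant. *)
have := pos (mink b b) (- mink a b); rewrite gt_eqF//= => /(_ isT).
rewrite !minkDl !minkDr !minkZl !minkZr (minkC b a).
move: (mink a a) (mink a b) => E F; move: (mink b b) b0 => G G0.
set lhs := (X in 0 < X -> _).
suff -> : lhs = G * (E * G - F ^+ 2) by rewrite pmulr_rgt0.
by rewrite /lhs; ring.
Qed.

Lemma frame_orthonormal (R : realType) (U : set 'rV[R]_2)
    (X nT nS : 'rV[R]_2 -> 'rV[R]_4) p :
  spacelike_surface U X -> future_normal_frame U X nT nS -> U p ->
  [/\ mink (nT p) (nT p) = -1, mink (nS p) (nS p) = 1
    & mink (nT p) (nS p) = 0].
Proof.
move=> [_ [sX iX _] sp] [[_ nTN] _ nT1 _ nSE] Up.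
have dX : differentiable X p by have [+ _] := sX 1%N; apply.
have [[_ tt] n1] := nT1 p Up.
have TT : mink (nT p) (nT p) = -1.
  have := congr1 (fun t => t ^+ 2) n1.
  by rewrite sqr_sqrtr ?normr_ge0// ltr0_norm// expr1n => <-; rewrite opprK.
have ort i : mink (nT p) (row i ('J X p)) = 0.
  by have /normal_planeP := nTN p Up; apply; rewrite genmxE row_sub.
have W0 := gram_spacelike_gt0 (sp p Up) (row_free_jacobian (iX p Up)).
rewrite -(mink_wedge_normal TT (ort 0) (ort 1)) in W0.
have := nSE p Up; rewrite /= (partialE 0 dX) (partialE 1 dX) => ->.
split=> //; first exact: mink_norm1_normalize.
by rewrite minkZr mink_wedgel mulr0.
Qed.

(** * The pointwise equivalences *)

Lemma lightcone_mean_curvature_eq0 (R : realType) (U : set 'rV[R]_2)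
    (X nT nS : 'rV[R]_2 -> 'rV[R]_4) p :
  spacelike_surface U X -> future_normal_frame U X nT nS -> U p ->
  (lightcone_mean_curvature_plus X nT nS p = 0 <->
     trace_shape X nT p + trace_shape X nS p = 0) /\
  (lightcone_mean_curvature_minus X nT nS p = 0 <->
     trace_shape X nT p - trace_shape X nS p = 0).
Proof.
move=> hX hn Up; have [TT SS TS] := frame_orthonormal hX hn Up.
case: hX hn => _ [_ iX _] sp [[sT nTN] [sS nSN] _ _ _].
have Xf := row_free_jacobian (iX p Up).
have TN0 := tangent_normal_trivial (sp p Up).
have dT : differentiable nT p by have [+ _] := sT 1%N; apply.
have dS : differentiable nS p by have [+ _] := sS 1%N; apply.
have half0 (t : R) : 2^-1 * t = 0 <-> t == 0.
  by split=> [h|/eqP ->]; [apply/eqP; lra | rewrite mulr0].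
split; apply: iff_trans (half0 _) _.
  have -> := trace_gauss_plus_eq0 Xf TN0 dT dS (nTN p Up) (nSN p Up) TT SS TS.
  by split=> /eqP.
have NN : ((- nS) p <= normal_plane X p)%MS by rewrite eqmx_opp; exact: nSN.
have NSS : mink (- nS p) (- nS p) = 1 by rewrite minkNr minkC minkNr opprK.
have NTS : mink (nT p) (- nS p) = 0 by rewrite minkNr TS oppr0.
have E := trace_gauss_plus_eq0 Xf TN0 dT (differentiableN dS) (nTN p Up) NN
  TT NSS NTS.
rewrite (trace_shapeN Xf dS) in E.
have -> : (trace_shape X (gauss_minus nT nS) p == 0) = _ := E.
by split=> /eqP.
Qed.

(* In the first equivalence the disjunction is taken at each point. With two
   separate global quantifiers the implication from left to right is false: see
   X(u,v) = (f + g, f - g, u, v) with f, g non-harmonic of disjoint supports. *)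
Theorem corollary4p4 (R : realType) (U : set 'rV[R]_2)
    (X nT nS : 'rV[R]_2 -> 'rV[R]_4)
    (hX : spacelike_surface U X) (hn : future_normal_frame U X nT nS) :
  (marginally_trapped U X nT nS <->
     (forall p, U p ->
        lightcone_mean_curvature_plus X nT nS p = 0 \/
        lightcone_mean_curvature_minus X nT nS p = 0)) /\
  (strongly_marginally_trapped U X nT nS <->
     (forall p, U p -> lightcone_mean_curvature_plus X nT nS p = 0) /\
     (forall p, U p -> lightcone_mean_curvature_minus X nT nS p = 0)).
Proof.
have iso p (Up : U p) : isotropic (mean_curvature_vector X nT nS p) <->
    lightcone_mean_curvature_plus X nT nS p = 0 \/
    lightcone_mean_curvature_minus X nT nS p = 0.
  have [TT SS TS] := frame_orthonormal hX hn Up.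
  apply: iff_trans (isotropic_half_lincomb _ _ TT SS TS) _.
  have [Lp Lm] := lightcone_mean_curvature_eq0 hX hn Up.
  split=> -[h|h]; [left | right | left | right].
  - exact: Lp.2 h.
  - exact: Lm.2 h.
  - exact: Lp.1 h.
  - exact: Lm.1 h.
have zero p (Up : U p) : mean_curvature_vector X nT nS p = 0 <->
    lightcone_mean_curvature_plus X nT nS p = 0 /\
    lightcone_mean_curvature_minus X nT nS p = 0.
  have [TT SS TS] := frame_orthonormal hX hn Up.
  apply: iff_trans (half_lincomb_eq0 _ _ TT SS TS) _.
  have [Lp Lm] := lightcone_mean_curvature_eq0 hX hn Up.
  split=> -[hp hm]; first exact: conj (Lp.2 hp) (Lm.2 hm).
  exact: conj (Lp.1 hp) (Lm.1 hm).
split; split.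
- by move=> MT p Up; exact: (iso p Up).1 (MT p Up).
- by move=> H p Up; exact: (iso p Up).2 (H p Up).
- by move=> ST; split=> p Up; have [] := (zero p Up).1 (ST p Up).
- by move=> [Hp Hm] p Up; exact: (zero p Up).2 (conj (Hp p Up) (Hm p Up)).
Qed.
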